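(* In BISH supplemented by the Church-Markov-Turing thesis, there exists a uniformly continuous, Z-stable mapping $f:[0,1]\to\mathbf{R}$, with zero set $Z_f=\{x\in[0,1]:f(x)=0\}$ inhabited and located in $[0,1]$, that is not uniformly Z-stable on $[0,1]$.
   Context: The setting is Bishop-style constructive mathematics (BISH), that is, intuitionistic logic together with dependent choice, supplemented by the Church-Markov-Turing thesis (CMT): every function from $\mathbf{N}$ to $\mathbf{N}$ is recursive. Neither the law of excluded middle, nor LPO, nor Markov's principle may be used. For $x\in[0,1]$, $S\subset[0,1]$ and $\varepsilon>0$, the expression $\rho(x,S)<\varepsilon$ means that there exists $y\in S$ with $|x-y|<\varepsilon$. A subset $S$ of $[0,1]$ is located if the distance $\rho(x,S)=\inf\{|x-y|:y\in S\}$ exists for each $x\in[0,1]$. A mapping $f:[0,1]\to\mathbf{R}$ is Z-stable if for each $x\in[0,1]$ and each $\varepsilon>0$ there exists $\delta>0$ such that if $|f(x)|<\delta$, then $\rho(x,Z_f)<\varepsilon$. It is uniformly Z-stable on $[0,1]$ if for each $\varepsilon>0$ there exists $\delta>0$ such that for each $x\in[0,1]$, if $|f(x)|<\delta$, then $\rho(x,Z_f)<\varepsilon$. *)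

(* Defs.v *)
From Stdlib Require Import Vector Fin.
From Stdlib Require Export ChoiceFacts.
From Stdlib Require Import ConstructiveCauchyReals ConstructiveCauchyAbs.

Set Implicit Arguments.
Unset Strict Implicit.
Unset Printing Implicit Defensive.

(* The ambient logic is Rocq's own intuitionistic logic, with no axioms. In
   particular the real numbers are the axiom-free Cauchy reals [CReal]: the
   type [R] of Stdlib rests on LPO, which the Church-Markov-Turing thesis
   refutes. Dependent choice, which is not derivable for [exists] in [Prop], is
   [FunctionalDependentChoice] of [ChoiceFacts]. *)

(* Codes of the partial recursive functions of each arity. *)
Inductive rec_code : nat -> Set :=
| rc_zero : rec_code 0
| rc_succ : rec_code 1
| rc_proj : forall n, Fin.t n -> rec_code n
| rc_comp : forall n m, rec_code m -> Vector.t (rec_code n) m -> rec_code n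
| rc_prim : forall n, rec_code n -> rec_code (S (S n)) -> rec_code (S n)
| rc_min : forall n, rec_code (S n) -> rec_code n.

(* [computes e v y]: the partial function with code [e] is defined at [v], with
   value [y]. In [computes_min] the function [z] records the (finitely many
   relevant) nonzero values below the least zero, so that minimization is
   defined only if all the earlier values are. *)
Inductive computes : forall n, rec_code n -> Vector.t nat n -> nat -> Prop :=
| computes_zero :
    computes rc_zero (Vector.nil nat) 0
| computes_succ : forall x,
    computes rc_succ (Vector.cons nat x 0 (Vector.nil nat)) (S x)
| computes_proj : forall n (i : Fin.t n) (v : Vector.t nat n),
    computes (rc_proj i) v (Vector.nth v i)
| computes_comp : forall n m (f : rec_code m) (gs : Vector.t (rec_code n) m)
    (v : Vector.t nat n) (w : Vector.t nat m) y,
    (forall i, computes (Vector.nth gs i) v (Vector.nth w i)) ->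
    computes f w y ->
    computes (rc_comp f gs) v y
| computes_prim_0 : forall n (f : rec_code n) (g : rec_code (S (S n)))
    (v : Vector.t nat n) y,
    computes f v y ->
    computes (rc_prim f g) (Vector.cons nat 0 n v) y
| computes_prim_S : forall n (f : rec_code n) (g : rec_code (S (S n)))
    (v : Vector.t nat n) k y z,
    computes (rc_prim f g) (Vector.cons nat k n v) y ->
    computes g (Vector.cons nat k (S n) (Vector.cons nat y n v)) z ->
    computes (rc_prim f g) (Vector.cons nat (S k) n v) z
| computes_min : forall n (f : rec_code (S n)) (v : Vector.t nat n) y
    (z : nat -> nat),
    computes f (Vector.cons nat y n v) 0 ->
    (forall k, (k < y)%nat -> computes f (Vector.cons nat k n v) (S (z k))) ->
    computes (rc_min f) v y.

Definition recursive (f : nat -> nat) : Prop :=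
  exists e : rec_code 1,
    forall n, computes e (Vector.cons nat n 0 (Vector.nil nat)) (f n).

Definition ChurchMarkovTuring : Prop := forall f : nat -> nat, recursive f.

(* The relation [<] of [CReal_scope] lives in [Set]; [<'] is its propositional
   form, to be used under [exists] and [/\]. The two are interderivable, by
   [CRealLtEpsilon] and [CRealLtForget]. *)
Notation "x <' y" := (CRealLtProp x y) (at level 70, no associativity)
  : CReal_scope.

Local Open Scope CReal_scope.

Record unit_interval : Set := UnitInterval {
  ui_val :> CReal;
  ui_bounds : 0 <= ui_val <= 1
}.

(* Equality of real numbers is the setoid equality [==], which a mapping has to
   respect. *)
Record mapping : Set := Mapping {
  map_fun :> unit_interval -> CReal;
  map_ext : forall x y : unit_interval, x == y -> map_fun x == map_fun y
}.

Definition zero_set (f : mapping) : unit_interval -> Prop :=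
  fun x => f x == 0.

Definition inhabited_subset (S : unit_interval -> Prop) : Prop :=
  exists x, S x.

(* rho(x, S) < eps; this does not require the distance to exist. *)
Definition dist_lt (x : unit_interval) (S : unit_interval -> Prop)
    (eps : CReal) : Prop :=
  exists y : unit_interval, S y /\ CReal_abs (x - y) <' eps.

(* [d] is the infimum of the |x - y| with [y] in [S], in the constructive sense:
   a lower bound to which elements of the set come arbitrarily close. *)
Definition is_dist (x : unit_interval) (S : unit_interval -> Prop)
    (d : CReal) : Prop :=
  (forall y : unit_interval, S y -> d <= CReal_abs (x - y)) /\
  (forall eps : CReal, 0 <' eps ->
     exists y : unit_interval, S y /\ CReal_abs (x - y) <' d + eps).

Definition located (S : unit_interval -> Prop) : Prop :=
  forall x : unit_interval, exists d : CReal, is_dist x S d.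

Definition uniformly_continuous (f : mapping) : Prop :=
  forall eps : CReal, 0 <' eps ->
  exists delta : CReal, 0 <' delta /\
    forall x y : unit_interval,
      CReal_abs (x - y) <' delta -> CReal_abs (f x - f y) <' eps.

Definition Z_stable (f : mapping) : Prop :=
  forall (x : unit_interval) (eps : CReal), 0 <' eps ->
  exists delta : CReal, 0 <' delta /\
    (CReal_abs (f x) <' delta -> dist_lt x (zero_set f) eps).

Definition uniformly_Z_stable (f : mapping) : Prop :=
  forall eps : CReal, 0 <' eps ->
  exists delta : CReal, 0 <' delta /\
    forall x : unit_interval,
      CReal_abs (f x) <' delta -> dist_lt x (zero_set f) eps.

(* Main.v *)
Require Import Defs.
From Stdlib Require Vector Fin.
From Stdlib Require Import Arith Lia List Cantor ZArith QArith Qabs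
  Qpower Lqa.
From Stdlib Require Import ConstructiveCauchyReals ConstructiveCauchyRealsMult
  ConstructiveCauchyAbs ConstructiveRcomplete.
Import ListNotations.

Set Implicit Arguments.
Unset Strict Implicit.
Unset Printing Implicit Defensive.

(* Under CMT there is a singular cover: a sequence of rational intervals I_n
   that covers every real number, although no finite subfamily covers [0,1].
   The k-th partial recursive function contributes, as soon as its value at k is
   computed, the interval of radius 2^-(2k+2) around the rational coded by that
   value; a real x lies in the interval contributed by a code of a function
   k |-> (rational within 2^-(2k+2) of x). Finitely many of the intervals are
   avoided by passing to nested quarters, one index k at a time.

   Let h(x) be the sum over n of 2^-(n+1) max(r_n - |x - c_n|, 0), with c_n and
   r_n the centre and the radius of I_n. Then h is 1-Lipschitz, positive at each
   x, and arbitrarily small. So f(x) = x h(x) has 0 as its only zero and is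
   positive elsewhere, which makes it Z-stable. An interval I_n around 0 stays
   in every finite subfamily from n on, so the points at which f is small can be
   taken outside it, that is, at a fixed distance from the zero. *)

(** * Step-indexed evaluation and enumeration of the recursive codes *)

Local Open Scope nat_scope.

(** This filter is closed under finite conjunctions, so completeness arguments need no explicit
    stage bounds. *)
Definition eventually (P : nat -> Prop) : Prop :=
  exists s0, forall s, s0 <= s -> P s.

Lemma eventually_step (P Q : nat -> Prop) :
  (forall s, P s -> Q (S s)) -> eventually P -> eventually Q.
Proof.
  intros PQ [s0 HP]; exists (S s0); intros [|s] Hs; [lia|].
  apply PQ, HP; lia.
Qed.

Lemma eventually_and (P Q : nat -> Prop) :
  eventually P -> eventually Q -> eventually (fun s => P s /\ Q s).
Proof.
  intros [s0 HP] [s1 HQ]; exists (s0 + s1); intros s Hs.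
  split; [apply HP | apply HQ]; lia.
Qed.

Lemma eventually_ge (m : nat) : eventually (fun s => m <= s).
Proof. exists m; auto. Qed.

Lemma eventually_forall_lt (P : nat -> nat -> Prop) (m : nat) :
  (forall k, k < m -> eventually (P k)) ->
  eventually (fun s => forall k, k < m -> P k s).
Proof.
  induction m as [|m IH]; intros HP.
  - exists 0; intros; lia.
  - destruct (eventually_and (IH (fun k Hk => HP k (Nat.lt_lt_succ_r _ _ Hk)))
                (HP m (Nat.lt_succ_diag_r m))) as [s0 H].
    exists s0; intros s Hs k Hk; destruct (H s Hs) as [H1 H2].
    destruct (Nat.eq_dec k m) as [->|]; [exact H2 | apply H1; lia].
Qed.

Lemma eventually_forall_fin (m : nat) (P : Fin.t m -> nat -> Prop) :
  (forall i, eventually (P i)) -> eventually (fun s => forall i, P i s).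
Proof.
  induction m as [|m IH]; intros HP.
  - exists 0; intros s _ i; inversion i.
  - destruct (eventually_and (HP Fin.F1)
                (IH (fun i => P (Fin.FS i)) (fun i => HP (Fin.FS i)))) as [s0 H].
    exists s0; intros s Hs i; destruct (H s Hs) as [H1 H2].
    apply (Fin.caseS' i (fun i => P i s)); assumption.
Qed.

Fixpoint all_some (A : Type) (m : nat) (v : Vector.t (option A) m) :
    option (Vector.t A m) :=
  match v with
  | Vector.nil _ => Some (Vector.nil A)
  | Vector.cons _ o _ v' =>
      match o, all_some v' with
      | Some a, Some w => Some (Vector.cons A a _ w)
      | _, _ => None
      end
  end.

Lemma all_some_nth (A : Type) (m : nat) (v : Vector.t (option A) m)
    (w : Vector.t A m) :
  (forall i, Vector.nth v i = Some (Vector.nth w i)) -> all_some v = Some w.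
Proof.
  revert m v w; refine (@Vector.rect2 _ _ (fun m v w =>
    (forall i, Vector.nth v i = Some (Vector.nth w i)) -> all_some v = Some w)
    _ _); simpl; [reflexivity|].
  intros n v w IH o a H.
  pose proof (H Fin.F1) as H0; simpl in H0; subst o.
  rewrite IH; [reflexivity | intros i; exact (H (Fin.FS i))].
Qed.

Lemma all_some_inv (A : Type) (m : nat) (v : Vector.t (option A) m)
    (w : Vector.t A m) :
  all_some v = Some w -> forall i, Vector.nth v i = Some (Vector.nth w i).
Proof.
  revert m v w; refine (@Vector.rect2 _ _ (fun m v w =>
    all_some v = Some w -> forall i, Vector.nth v i = Some (Vector.nth w i))
    _ _); simpl; [intros _ i; inversion i|].
  intros n v w IH [b|] a; [|discriminate].
  destruct (all_some v) as [w'|]; [|discriminate].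
  intros H; injection H as -> Hw.
  (* The tails are equal only as dependent pairs; decidable equality of the length removes the
     dependency without an axiom. *)
  apply Eqdep_dec.inj_pair2_eq_dec in Hw; [subst w' | exact Nat.eq_dec].
  intros i; apply (Fin.caseS' i (fun i => Vector.nth (Vector.cons _ (Some a) _ v) i
    = Some (Vector.nth (Vector.cons _ a _ w) i))); simpl; auto.
Qed.

(** The search stops with [None] at the first undefined value, in accordance with [computes_min]. *)
Fixpoint least_zero (F : nat -> option nat) (fuel k : nat) : option nat :=
  match fuel with
  | 0 => None
  | S fuel' =>
      match F k with
      | Some 0 => Some k
      | Some (S _) => least_zero F fuel' (S k)
      | None => None
      end
  end.

Lemma least_zero_spec (F : nat -> option nat) (d fuel k : nat) :
  d < fuel -> F (k + d) = Some 0 ->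
  (forall j, j < d -> exists z, F (k + j) = Some (S z)) ->
  least_zero F fuel k = Some (k + d).
Proof.
  revert fuel k; induction d as [|d IH]; intros [|fuel] k Hd H0 HS; try lia; simpl.
  - rewrite Nat.add_0_r in *; rewrite H0; reflexivity.
  - destruct (HS 0) as [z Hz]; [lia|]; rewrite Nat.add_0_r in Hz; rewrite Hz.
    rewrite IH; [f_equal; lia | lia | rewrite <- H0; f_equal; lia |].
    intros j Hj; destruct (HS (S j)) as [z' Hz']; [lia|].
    exists z'; rewrite <- Hz'; f_equal; lia.
Qed.

(** The fuel grows by one because [eval] uses its stage both as fuel and as the stage of the values
    searched. *)
Lemma least_zero_mono (F G : nat -> option nat) (fuel k y : nat) :
  (forall j z, F j = Some z -> G j = Some z) ->
  least_zero F fuel k = Some y -> least_zero G (S fuel) k = Some y.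
Proof.
  intros FG; revert k; induction fuel as [|fuel IH]; intros k; [discriminate|].
  intros H; simpl in H; destruct (F k) as [z|] eqn:E; [|discriminate].
  change (least_zero G (S (S fuel)) k) with
    (match G k with
     | Some 0 => Some k
     | Some (S _) => least_zero G (S fuel) (S k)
     | None => None
     end).
  rewrite (FG _ _ E); destruct z; auto.
Qed.

(** Every recursive call lowers the stage [s], including the call on the unchanged code in the
    [rc_prim] case and those on codes inside a vector, so recursion on [s] is structural. *)
Fixpoint eval (s n : nat) (e : rec_code n) {struct s} :
    Vector.t nat n -> option nat :=
  match s with
  | 0 => fun _ => None
  | S s' =>
      match e in rec_code n return Vector.t nat n -> option nat with
      | rc_zero => fun _ => Some 0
      | rc_succ => fun v => Some (S (Vector.hd v))
      | rc_proj i => fun v => Some (Vector.nth v i)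
      | rc_comp f gs => fun v =>
          match all_some (Vector.map (fun g => eval s' g v) gs) with
          | Some w => eval s' f w
          | None => None
          end
      | @rc_prim m f g => fun v =>
          match Vector.hd v with
          | 0 => eval s' f (Vector.tl v)
          | S k =>
              match eval s' (rc_prim f g)
                      (Vector.cons nat k _ (Vector.tl v)) with
              | Some y =>
                  eval s' g
                    (Vector.cons nat k _ (Vector.cons nat y _ (Vector.tl v)))
              | None => None
              end
          end
      | @rc_min m f => fun v =>
          least_zero (fun k => eval s' f (Vector.cons nat k _ v)) s' 0
      end
  end.

Lemma eval_comp (s n m : nat) (f : rec_code m) (gs : Vector.t (rec_code n) m)
    (v : Vector.t nat n) :
  eval (S s) (rc_comp f gs) v =
  match all_some (Vector.map (fun g => eval s g v) gs) with
  | Some w => eval s f w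
  | None => None
  end.
Proof. reflexivity. Qed.

Lemma eval_prim (s n : nat) (f : rec_code n) (g : rec_code (S (S n)))
    (v : Vector.t nat (S n)) :
  eval (S s) (rc_prim f g) v =
  match Vector.hd v with
  | 0 => eval s f (Vector.tl v)
  | S k =>
      match eval s (rc_prim f g) (Vector.cons nat k _ (Vector.tl v)) with
      | Some y =>
          eval s g (Vector.cons nat k _ (Vector.cons nat y _ (Vector.tl v)))
      | None => None
      end
  end.
Proof. reflexivity. Qed.

Lemma eval_step (s n : nat) (e : rec_code n) (v : Vector.t nat n) (y : nat) :
  eval s e v = Some y -> eval (S s) e v = Some y.
Proof.
  revert n e v y; induction s as [|s IH]; intros n e v y; [discriminate|].
  destruct e as [| |n i|n m f gs|n f g|n f]; try (intros H; exact H).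
  - rewrite !eval_comp.
    destruct (all_some (Vector.map (fun g => eval s g v) gs)) as [w|] eqn:E;
      [|discriminate].
    intros H; rewrite (all_some_nth (w := w)); [exact (IH _ _ _ _ H)|].
    intros i; pose proof (all_some_inv E i) as Hi.
    rewrite (Vector.nth_map _ _ i i eq_refl) in Hi.
    rewrite (Vector.nth_map _ _ i i eq_refl); exact (IH _ _ _ _ Hi).
  - rewrite !eval_prim.
    destruct (Vector.hd v) as [|k]; [apply IH|].
    destruct (eval s (rc_prim f g) _) as [z|] eqn:E; [|discriminate].
    rewrite (IH _ _ _ _ E); apply IH.
  - apply least_zero_mono; intros j z; apply IH.
Qed.

Lemma eval_mono (s s' n : nat) (e : rec_code n) (v : Vector.t nat n) (y : nat) :
  s <= s' -> eval s e v = Some y -> eval s' e v = Some y.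
Proof. induction 1 as [|s' _ IH]; [auto | intros H; now apply eval_step, IH]. Qed.

(** Induction on the derivation: each rule has finitely many premises, so from some stage on all of
    them are available together. *)
Lemma eval_complete (n : nat) (e : rec_code n) (v : Vector.t nat n) (y : nat) :
  computes e v y -> eventually (fun s => eval s e v = Some y).
Proof.
  induction 1 as [|x|n i v|n m f gs v w y _ IHg _ IHf|n f g v y _ IHf
    |n f g v k y z _ IHr _ IHg|n f v y z _ IH0 _ IHS].
  - exists 1; intros [|s] Hs; [lia|reflexivity].
  - exists 1; intros [|s] Hs; [lia|reflexivity].
  - exists 1; intros [|s] Hs; [lia|reflexivity].
  - refine (eventually_step _
      (eventually_and (eventually_forall_fin IHg) IHf)).
    intros s [Hg Hf]; simpl.
    rewrite (all_some_nth (w := w)); [exact Hf|].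
    intros i; rewrite (Vector.nth_map _ _ i i eq_refl); apply Hg.
  - refine (eventually_step _ IHf); auto.
  - refine (eventually_step _ (eventually_and IHr IHg)).
    intros s [Hr Hg]; simpl; rewrite Hr; exact Hg.
  - refine (eventually_step _ (eventually_and (eventually_ge (S y))
      (eventually_and IH0 (eventually_forall_lt IHS)))).
    intros s (Hs & H0 & HS); simpl.
    apply (least_zero_spec (d := y) (k := 0)); [exact Hs | exact H0 |].
    intros j Hj; exists (z j); exact (HS j Hj).
Qed.

(* The generated induction principle has no hypothesis for the codes inside the
   vector of [rc_comp]. *)
Definition rec_code_nested_ind (P : forall n, rec_code n -> Prop)
    (Pzero : P 0 rc_zero) (Psucc : P 1 rc_succ)
    (Pproj : forall n (i : Fin.t n), P n (rc_proj i))
    (Pcomp : forall n m (f : rec_code m) (gs : Vector.t (rec_code n) m),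
      P m f -> (forall i, P n (Vector.nth gs i)) -> P n (rc_comp f gs))
    (Pprim : forall n (f : rec_code n) (g : rec_code (S (S n))),
      P n f -> P (S (S n)) g -> P (S n) (rc_prim f g))
    (Pmin : forall n (f : rec_code (S n)), P (S n) f -> P n (rc_min f)) :
    forall n (e : rec_code n), P n e :=
  fix ind (n : nat) (e : rec_code n) : P n e :=
    match e with
    | rc_zero => Pzero
    | rc_succ => Psucc
    | rc_proj i => Pproj _ i
    | @rc_comp n m f gs =>
        Pcomp _ _ f gs (ind _ f)
          ((fix all m (gs : Vector.t (rec_code n) m) :
                forall i, P n (Vector.nth gs i) :=
              match gs with
              | Vector.nil _ =>
                  Fin.case0 (fun i => P n (Vector.nth (Vector.nil _) i))
              | Vector.cons _ g _ gs' => fun i =>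
                  Fin.caseS' i
                    (fun i => P n (Vector.nth (Vector.cons _ g _ gs') i))
                    (ind _ g) (all _ gs')
              end) m gs)
    | rc_prim f g => Pprim _ f g (ind _ f) (ind _ g)
    | rc_min f => Pmin _ f (ind _ f)
    end.

(** * Enumeration of the codes and the diagonal partial function *)

Fixpoint fins (n : nat) : list (Fin.t n) :=
  match n with
  | 0 => []
  | S n' => Fin.F1 :: map Fin.FS (fins n')
  end.

Lemma in_fins (n : nat) (i : Fin.t n) : In i (fins n).
Proof. induction i; simpl; [left; reflexivity | right; now apply in_map]. Qed.

Fixpoint vectors (A : Type) (l : list A) (m : nat) : list (Vector.t A m) :=
  match m with
  | 0 => [Vector.nil A]
  | S m' => flat_map (fun a => map (Vector.cons A a m') (vectors l m')) l
  end.

Lemma in_vectors (A : Type) (l : list A) (m : nat) (v : Vector.t A m) :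
  (forall i, In (Vector.nth v i) l) -> In v (vectors l m).
Proof.
  induction v as [|a m v IH]; intros H; simpl; [left; reflexivity|].
  apply in_flat_map; exists a; split; [exact (H Fin.F1)|].
  apply in_map, IH; intros i; exact (H (Fin.FS i)).
Qed.

(** The stage bounds the depth of a code and also the inner arity [m] of a composition, which keeps
    each list finite. *)
Fixpoint codes (s n : nat) {struct s} : list (rec_code n) :=
  match s with
  | 0 => []
  | S s' =>
      match n return list (rec_code n) with
      | 0 => [rc_zero]
      | 1 => [rc_succ]
      | _ => []
      end
      ++ map (@rc_proj n) (fins n)
      ++ flat_map (fun m =>
           flat_map (fun f => map (rc_comp f) (vectors (codes s' n) m))
             (codes s' m)) (List.seq 0 s')
      ++ match n return list (rec_code n) with
         | 0 => []
         | S n' =>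
             flat_map (fun f => map (rc_prim f) (codes s' (S (S n'))))
               (codes s' n')
         end
      ++ map (@rc_min n) (codes s' (S n))
  end.

Lemma in_codes (n : nat) (e : rec_code n) :
  eventually (fun s => In e (codes s n)).
Proof.
  revert n e; apply rec_code_nested_ind.
  - exists 1; intros [|s] Hs; [lia|]; left; reflexivity.
  - exists 1; intros [|s] Hs; [lia|]; left; reflexivity.
  - intros n i; exists 1; intros [|s] Hs; [lia|]; simpl.
    apply in_or_app; right; apply in_or_app; left; apply in_map, in_fins.
  - intros n m f gs IHf IHg.
    refine (eventually_step _ (eventually_and (eventually_ge (S m))
      (eventually_and IHf (eventually_forall_fin IHg)))).
    intros s (Hs & Hf & Hg); simpl.
    apply in_or_app; right; apply in_or_app; right; apply in_or_app; left.
    apply in_flat_map; exists m; split; [apply in_seq; lia|].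
    apply in_flat_map; exists f; split; [exact Hf|].
    apply in_map, in_vectors, Hg.
  - intros n f g IHf IHg.
    refine (eventually_step _ (eventually_and IHf IHg)).
    intros s (Hf & Hg); cbn [codes].
    do 3 (apply in_or_app; right); apply in_or_app; left.
    apply in_flat_map; exists f; split; [exact Hf | now apply in_map].
  - intros n f IHf; refine (eventually_step _ IHf).
    intros s Hf; simpl; do 4 (apply in_or_app; right); now apply in_map.
Qed.

(** The number [k] encodes a stage and a position in the list of that stage; positions past its end
    name no code. *)
Definition code (k : nat) : option (rec_code 1) :=
  let (s, j) := Cantor.of_nat k in nth_error (codes s 1) j.

Lemma code_surjective (e : rec_code 1) : exists k, code k = Some e.
Proof.
  destruct (in_codes e) as [s Hs].
  destruct (In_nth_error _ _ (Hs s (le_n s))) as [j Hj].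
  exists (Cantor.to_nat (s, j)); unfold code; rewrite Cantor.cancel_of_to; exact Hj.
Qed.

Definition diagonal (k s : nat) : option nat :=
  match code k with
  | Some e => eval s e (Vector.cons nat k 0 (Vector.nil nat))
  | None => None
  end.


(** Consequently all values found for one index [k], at whatever stages, agree. *)
Lemma diagonal_mono (k s s' y : nat) :
  s <= s' -> diagonal k s = Some y -> diagonal k s' = Some y.
Proof. unfold diagonal; destruct (code k); [apply eval_mono | auto]. Qed.

(** By CMT [f] has a code; if [k] is a number of that code, the diagonal computes [f] at this same
    [k]. *)
Lemma diagonal_complete (CMT : ChurchMarkovTuring) (f : nat -> nat) :
  exists k s, diagonal k s = Some (f k).
Proof.
  destruct (CMT f) as [e He]; destruct (code_surjective e) as [k Hk].
  destruct (eval_complete (He k)) as [s Hs].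
  exists k, s; unfold diagonal; rewrite Hk; apply Hs, le_n.
Qed.

(** * The singular cover *)

(** The numerator is stored as its positive and negative parts, whose difference gives it back. *)
Definition encode_Q (q : Q) : nat :=
  Cantor.to_nat (Cantor.to_nat (Z.to_nat (Qnum q), Z.to_nat (- Qnum q)),
                 Pos.to_nat (Qden q)).

Definition decode_Q (m : nat) : Q :=
  let (a, d) := Cantor.of_nat m in
  let (p, n) := Cantor.of_nat a in
  (Z.of_nat p - Z.of_nat n) # Pos.of_nat d.

Lemma decode_encode_Q (q : Q) : decode_Q (encode_Q q) = q.
Proof.
  destruct q as [z d]; unfold decode_Q, encode_Q.
  rewrite !Cantor.cancel_of_to; cbn [Qnum Qden]; rewrite Pos2Nat.id.
  f_equal; lia.
Qed.

Definition dyad (n : nat) : Q := (2 ^ (- Z.of_nat n))%Q.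

Lemma dyad_pos (n : nat) : (0 < dyad n)%Q.
Proof. apply Qpower_0_lt; reflexivity. Qed.

Lemma dyad_S (n : nat) : (dyad n == dyad (S n) + dyad (S n))%Q.
Proof.
  unfold dyad; replace (- Z.of_nat n)%Z with (- Z.of_nat (S n) + 1)%Z by lia.
  rewrite Qpower_plus by discriminate; change (2 ^ 1)%Q with 2%Q; ring.
Qed.

Lemma dyad_archimedean (p : positive) : (dyad (Pos.to_nat p) <= 1 # p)%Q.
Proof.
  pose proof (Qpower_2powneg_le_inv p) as H; unfold dyad.
  rewrite positive_nat_Z; change (- Z.pos p)%Z with (Z.neg p).
  pose proof (Qpower_0_lt 2 (Z.neg p) eq_refl); lra.
Qed.

Lemma dyad_antitone (n m : nat) : (n <= m)%nat -> (dyad m <= dyad n)%Q.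
Proof.
  induction 1 as [|m _ IH]; [apply Qle_refl|].
  pose proof (dyad_S m); pose proof (dyad_pos (S m)); lra.
Qed.

(** A quarter of [dyad (2 * k)], the length that remains when index [k] comes to be avoided. *)
Definition radius (k : nat) : Q := dyad (2 * k + 2).

(** A pair of centre and radius. A stage without a value yields radius 0, hence an empty open
    interval. *)
Definition interval (n : nat) : Q * Q :=
  let (k, s) := Cantor.of_nat n in
  match diagonal k s with
  | Some y => (decode_Q y, radius k)
  | None => (0, 0)
  end%Q.

Lemma dyad_le_1 (n : nat) : (dyad n <= 1)%Q.
Proof.
  induction n as [|n IH]; [apply Qle_refl|].
  pose proof (dyad_S n); pose proof (dyad_pos (S n)); lra.
Qed.

Lemma interval_radius_le_1 (n : nat) : (snd (interval n) <= 1)%Q.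
Proof.
  unfold interval; destruct (Cantor.of_nat n) as [k s].
  destruct (diagonal k s); [apply dyad_le_1 | discriminate].
Qed.

(** With r = [radius m], the current interval is [a, a + 4r]. If c_m < a + 2r, then c_m + r < a + 3r
    and the last quarter is kept; otherwise a + r <= c_m - r and the first is kept. The case split
    is decidable since all data are rational. *)
Lemma nested_quarters (c : nat -> Q) (m : nat) :
  exists a : Q, (0 <= a /\ a + dyad (2 * m) <= 1)%Q /\
    forall k y, (k < m)%nat -> (a <= y <= a + dyad (2 * m))%Q ->
      (y <= c k - radius k \/ c k + radius k <= y)%Q.
Proof.
  induction m as [|m (a & Ha & IH)].
  - exists 0%Q; split; [split; discriminate | intros; lia].
  - assert (Hr : (dyad (2 * m) == 4 * radius m)%Q).
    { unfold radius; rewrite (dyad_S (2 * m)), (dyad_S (S (2 * m))).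
      replace (2 * m + 2)%nat with (S (S (2 * m))) by lia; ring. }
    replace (2 * S m)%nat with (2 * m + 2)%nat by lia; fold (radius m).
    assert (Hp : (0 < radius m)%Q) by apply dyad_pos.
    destruct (Qlt_le_dec (c m) (a + 2 * radius m)) as [Hc|Hc].
    + exists (a + 3 * radius m)%Q; split; [lra|].
      intros k y Hk Hy; destruct (Nat.eq_dec k m) as [->|]; [right; lra|].
      apply IH; [lia | lra].
    + exists a; split; [lra|].
      intros k y Hk Hy; destruct (Nat.eq_dec k m) as [->|]; [left; lra|].
      apply IH; [lia | lra].
Qed.

(** A pair (k, s) numbered below [N] has k < N and s < N, so a value found at stage [s] is still the
    value at stage [N]. Avoiding one interval for each k < N is therefore enough. *)
Lemma interval_finite_avoid (N : nat) :
  exists a : Q, (0 <= a <= 1)%Q /\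
    forall n, (n < N)%nat ->
      (a <= fst (interval n) - snd (interval n) \/
       fst (interval n) + snd (interval n) <= a)%Q.
Proof.
  destruct (nested_quarters
    (fun k => match diagonal k N with Some y => decode_Q y | None => 0%Q end) N)
    as (a & Ha & Havoid).
  pose proof (dyad_pos (2 * N)) as Hp.
  exists a; split; [lra|]; intros n Hn; unfold interval.
  destruct (Cantor.of_nat n) as [k s] eqn:E.
  assert (Hks : (s + k <= n)%nat).
  { rewrite <- (Cantor.cancel_to_of n), E; apply Cantor.to_nat_non_decreasing. }
  (* The empty interval at 0 lies to the left of [a] because 0 <= a. *)
  destruct (diagonal k s) as [y|] eqn:Ey; cbn [fst snd]; [|right; lra].
  specialize (Havoid k a); cbv beta in Havoid.
  assert (HsN : (s <= N)%nat) by lia.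
  rewrite (diagonal_mono HsN Ey) in Havoid.
  apply Havoid; [lia | lra].
Qed.

(** * Inequalities between Cauchy reals and the covering property *)

Local Open Scope CReal_scope.

(** Turns a linear consequence of known inequalities into an identity for [ring]. *)
Lemma CReal_le_of_sub (a b c d : CReal) : a <= b -> d - c == b - a -> c <= d.
Proof.
  intros H E; apply (CReal_plus_le_reg_l (a - c)).
  setoid_replace (a - c + c) with a by ring.
  setoid_replace (a - c + d) with (a + (d - c)) by ring; rewrite E.
  setoid_replace (a + (b - a)) with b by ring; exact H.
Qed.

Lemma CReal_lt_of_sub (a b c d : CReal) : a < b -> d - c == b - a -> c < d.
Proof.
  intros H E; apply (CReal_plus_lt_reg_l (a - c)).
  apply (CRealLt_proper_l a); [ring|].
  apply (CRealLt_proper_r b); [|exact H].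
  setoid_replace (a - c + d) with (a + (d - c)) by ring; rewrite E; ring.
Qed.

(** Since [a <= b] is by definition the negation of [b < a], a refutation suffices: a rational q
    with 0 < q < a - b is at least 1 over its denominator. *)
Lemma CReal_le_plus_inv (a b : CReal) :
  (forall p : positive, a <= b + inject_Q (1 # p)) -> a <= b.
Proof.
  intros H Hba.
  assert (H0 : 0 < a - b) by (apply (CReal_lt_of_sub Hba); ring).
  destruct (CRealQ_dense _ _ H0) as (q & Hq0 & Hq).
  apply lt_inject_Q in Hq0.
  apply (H (Qden q)), (CReal_le_lt_trans _ (b + inject_Q q)).
  - apply CReal_plus_le_compat_l, inject_Q_le.
    destruct q as [z d]; unfold Qlt, Qle in *; simpl in *; nia.
  - apply (CReal_lt_of_sub Hq); ring.
Qed.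

Lemma interval_cover (CMT : ChurchMarkovTuring) (x : CReal) :
  exists n, CReal_abs (x - inject_Q (fst (interval n))) <'
            inject_Q (snd (interval n)).
Proof.
  assert (Hlt : forall k, x - inject_Q (radius k) < x + inject_Q (radius k)).
  { intros k; apply CReal_plus_lt_compat_l; rewrite <- opp_inject_Q.
    apply inject_Q_lt; pose proof (dyad_pos (2 * k + 2)); unfold radius; lra. }
  (* [CRealQ_dense] returns its rational in a sigma type, so the approximations form a function, to
     which CMT applies. *)
  destruct (diagonal_complete CMT
    (fun k => encode_Q (projT1 (CRealQ_dense _ _ (Hlt k))))) as (k & s & Hks).
  exists (Cantor.to_nat (k, s)); unfold interval.
  rewrite Cantor.cancel_of_to, Hks; cbn [fst snd]; rewrite decode_encode_Q.
  destruct (CRealQ_dense _ _ (Hlt k)) as (q & Hl & Hu); cbn [projT1].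
  apply CRealLtForget, Rabs_def1.
  - apply (CReal_lt_of_sub Hl); ring.
  - apply (CReal_lt_of_sub Hu); ring.
Qed.

(** * The mapping *)

Lemma CReal_abs_le_swap (a b d : CReal) :
  a <= b + d -> b <= a + d -> CReal_abs (a - b) <= d.
Proof.
  intros H1 H2; apply CReal_abs_le; split.
  - apply (CReal_le_of_sub H2); ring.
  - apply (CReal_le_of_sub H1); ring.
Qed.

(** * Series with weights 2^-(n+1) and terms in [0,1] *)

Fixpoint dyadic_sum (t : nat -> CReal) (n : nat) : CReal :=
  match n with
  | 0%nat => 0
  | S m => dyadic_sum t m + inject_Q (dyad (S m)) * t m
  end.

Lemma inject_dyad_pos (n : nat) : 0 < inject_Q (dyad n).
Proof. apply inject_Q_lt, dyad_pos. Qed.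

Lemma inject_dyad_S (n : nat) :
  inject_Q (dyad n) == inject_Q (dyad (S n)) + inject_Q (dyad (S n)).
Proof. rewrite <- inject_Q_plus; apply inject_Q_morph, dyad_S. Qed.

(** The weight of the term added at [m] is exactly the drop from [dyad m] to [dyad (S m)], and the
    term is at most its weight. *)
Lemma dyadic_sum_bounds (t : nat -> CReal) (n m : nat) :
  (forall i, 0 <= t i <= 1) -> (n <= m)%nat ->
  dyadic_sum t n <= dyadic_sum t m /\
  dyadic_sum t m + inject_Q (dyad m) <= dyadic_sum t n + inject_Q (dyad n).
Proof.
  intros Ht; induction 1 as [|m _ [IH1 IH2]]; [split; apply CRealLe_refl|].
  destruct (Ht m) as [H0 H1].
  pose proof (CRealLt_asym _ _ (inject_dyad_pos (S m))) as Hd.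
  simpl; split.
  - apply (CReal_le_trans _ _ _ IH1).
    apply (CReal_le_of_sub (CReal_mult_le_0_compat _ _ Hd H0)); ring.
  - apply (fun H => CReal_le_trans _ _ _ H IH2); rewrite (inject_dyad_S m).
    apply (CReal_le_of_sub (CReal_mult_le_compat_l _ _ _ Hd H1)); ring.
Qed.

(** The partial sums are Cauchy with modulus p, as 2^-p <= 1/p. The sigma type lets the limit serve
    as a function value. *)
Lemma dyadic_sum_limit (t : nat -> CReal) :
  (forall i, 0 <= t i <= 1) ->
  { l : CReal | forall n,
      dyadic_sum t n <= l <= dyadic_sum t n + inject_Q (dyad n) }.
Proof.
  intros Ht.
  assert (Hle : forall n m, (n <= m)%nat ->
    dyadic_sum t m <= dyadic_sum t n + inject_Q (dyad n)).
  { intros n m Hnm; apply (fun H => CReal_le_trans _ _ _ H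
      (proj2 (dyadic_sum_bounds Ht Hnm))).
    apply (CReal_le_of_sub (CRealLt_asym _ _ (inject_dyad_pos m))); ring. }
  assert (Hd : forall p, inject_Q (dyad (Pos.to_nat p)) <= inject_Q (1 # p)).
  { intros p; apply inject_Q_le, dyad_archimedean. }
  destruct (Rcauchy_complete (dyadic_sum t)) as [l Hl].
  - intros p; exists (Pos.to_nat p); intros i j Hi Hj.
    apply (fun H => CReal_le_trans _ _ _ H (Hd p)).
    assert (H : forall i j, (Pos.to_nat p <= i)%nat -> (Pos.to_nat p <= j)%nat ->
      dyadic_sum t i <= dyadic_sum t j + inject_Q (dyad (Pos.to_nat p))).
    { clear i j Hi Hj; intros i j Hi Hj; apply (CReal_le_trans _ _ _ (Hle _ _ Hi)).
      rewrite !(CReal_plus_comm _ (inject_Q _)); apply CReal_plus_le_compat_l.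
      apply (dyadic_sum_bounds Ht Hj). }
    apply CReal_abs_le_swap; apply H; assumption.
  - exists l; intros n.
    assert (Hi : forall p, exists i, (n <= i)%nat /\
      CReal_abs (dyadic_sum t i - l) <= inject_Q (1 # p)).
    { intros p; destruct (Hl p) as [m Hm]; exists (n + m)%nat.
      split; [lia | apply Hm; lia]. }
    split; apply CReal_le_plus_inv; intros p;
      destruct (Hi p) as (i & Hni & Habs);
      destruct (CReal_abs_def2 _ _ Habs) as [H1 H2].
    + apply (CReal_le_trans _ _ _ (proj1 (dyadic_sum_bounds Ht Hni))).
      apply (CReal_le_of_sub H1); ring.
    + apply (CReal_le_trans _ (dyadic_sum t i + inject_Q (1 # p))).
      * apply (CReal_le_of_sub H2); ring.
      * rewrite !(CReal_plus_comm _ (inject_Q (1 # p))).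
        apply CReal_plus_le_compat_l, Hle, Hni.
Qed.

Definition dyadic_series (t : nat -> CReal) (Ht : forall i, 0 <= t i <= 1) :
  CReal := proj1_sig (dyadic_sum_limit Ht).

Lemma dyadic_series_bounds (t : nat -> CReal) (Ht : forall i, 0 <= t i <= 1)
    (n : nat) :
  dyadic_sum t n <= dyadic_series Ht <= dyadic_sum t n + inject_Q (dyad n).
Proof. exact (proj2_sig (dyadic_sum_limit Ht) n). Qed.

(** The first [n] weights sum to 1 - 2^-n, so the error is (1 - 2^-n) d, written here without
    subtraction. *)
Lemma dyadic_sum_le (t u : nat -> CReal) (d : CReal) (n : nat) :
  (forall i, t i <= u i + d) ->
  dyadic_sum t n + inject_Q (dyad n) * d <= dyadic_sum u n + d.
Proof.
  intros Htu; induction n as [|n IH]; simpl.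
  - change (inject_Q (dyad 0)) with 1; apply (CReal_le_of_sub (CRealLe_refl d)); ring.
  - pose proof (CRealLt_asym _ _ (inject_dyad_pos (S n))) as Hd.
    pose proof (CReal_plus_le_compat _ _ _ _ IH
      (CReal_mult_le_compat_l _ _ _ Hd (Htu n))) as H.
    apply (CReal_le_of_sub H); rewrite (inject_dyad_S n); ring.
Qed.

Lemma dyadic_series_le (t u : nat -> CReal) (Ht : forall i, 0 <= t i <= 1)
    (Hu : forall i, 0 <= u i <= 1) (d : CReal) :
  0 <= d -> (forall i, t i <= u i + d) ->
  dyadic_series Ht <= dyadic_series Hu + d.
Proof.
  intros Hd Htu; apply CReal_le_plus_inv; intros p.
  set (n := Pos.to_nat p).
  assert (Hp : inject_Q (dyad n) <= inject_Q (1 # p)).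
  { apply inject_Q_le, dyad_archimedean. }
  apply (CReal_le_trans _ _ _ (proj2 (dyadic_series_bounds Ht n))).
  apply CReal_plus_le_compat; [|exact Hp].
  apply (CReal_le_trans _ (dyadic_sum u n + d)).
  - refine (CReal_le_trans _ _ _ _ (dyadic_sum_le (n := n) Htu)).
    apply (CReal_le_of_sub (CReal_mult_le_0_compat _ _
      (CRealLt_asym _ _ (inject_dyad_pos n)) Hd)); ring.
  - rewrite !(CReal_plus_comm _ d); apply CReal_plus_le_compat_l.
    apply dyadic_series_bounds.
Qed.

Lemma dyadic_series_pos (t : nat -> CReal) (Ht : forall i, 0 <= t i <= 1)
    (n : nat) : 0 < t n -> 0 < dyadic_series Ht.
Proof.
  intros Hn.
  apply (fun H => CReal_lt_le_trans _ _ _ H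
    (proj1 (dyadic_series_bounds Ht (S n)))); simpl.
  apply (CReal_lt_le_trans _ _ _ (CReal_mult_lt_0_compat _ _ (inject_dyad_pos (S n)) Hn)).
  apply (CReal_le_of_sub (proj1 (dyadic_sum_bounds Ht (Nat.le_0_l n)))); simpl; ring.
Qed.

(** Only the tail remains, and its total weight is 2^-n. *)
Lemma dyadic_series_small (t : nat -> CReal) (Ht : forall i, 0 <= t i <= 1)
    (n : nat) :
  (forall i, (i < n)%nat -> t i == 0) -> dyadic_series Ht <= inject_Q (dyad n).
Proof.
  intros H.
  assert (H0 : dyadic_sum t n == 0).
  { clear Ht; induction n as [|n IH]; simpl; [reflexivity|].
    rewrite IH, H by (intros; auto with arith); ring. }
  pose proof (proj2 (dyadic_series_bounds Ht n)) as H1.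
  rewrite H0, CReal_plus_0_l in H1; exact H1.
Qed.

(** * Bump functions of the intervals and their weighted sum h *)

Definition bump (I : Q * Q) (x : CReal) : CReal :=
  CReal_max (inject_Q (snd I) - CReal_abs (x - inject_Q (fst I))) 0.

Lemma bump_bounds (I : Q * Q) (x : CReal) :
  (snd I <= 1)%Q -> 0 <= bump I x <= 1.
Proof.
  intros Hr; split; [apply CReal_max_r|].
  apply CReal_max_lub; [|apply inject_Q_le; discriminate].
  apply (CReal_le_trans _ (inject_Q (snd I))); [|apply inject_Q_le, Hr].
  apply (CReal_le_of_sub (CReal_abs_pos (x - inject_Q (fst I)))); ring.
Qed.

Lemma bump_pos (I : Q * Q) (x : CReal) :
  CReal_abs (x - inject_Q (fst I)) < inject_Q (snd I) -> 0 < bump I x.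
Proof.
  intros H; refine (CReal_lt_le_trans _ _ _ _ (CReal_max_l _ _)).
  apply (CReal_lt_of_sub H); ring.
Qed.

Lemma bump_zero (I : Q * Q) (x : CReal) :
  inject_Q (snd I) <= CReal_abs (x - inject_Q (fst I)) -> bump I x == 0.
Proof.
  intros H; apply CReal_max_right, (CReal_le_of_sub H); ring.
Qed.

Lemma bump_lipschitz (I : Q * Q) (x y : CReal) :
  bump I x <= bump I y + CReal_abs (x - y).
Proof.
  assert (H : CReal_abs (bump I x - bump I y) <= CReal_abs (x - y)).
  { apply (CReal_le_trans _ _ _ (CReal_max_contract _ _ 0)).
    pose proof (CReal_abs_triang_inv2 (y - inject_Q (fst I)) (x - inject_Q (fst I))) as H.
    rewrite (CReal_abs_minus_sym x y).
    setoid_replace (y - x) with (y - inject_Q (fst I) - (x - inject_Q (fst I))) by ring.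
    refine (CRealLe_proper_l _ _ _ _ H).
    apply CReal_abs_morph; ring. }
  apply (CReal_le_of_sub (CReal_le_trans _ _ _ (CReal_le_abs _) H)); ring.
Qed.

Lemma interval_bump_bounds (x : CReal) (n : nat) :
  0 <= bump (interval n) x <= 1.
Proof. apply bump_bounds, interval_radius_le_1. Qed.

Definition height (x : CReal) : CReal := dyadic_series (interval_bump_bounds x).

Lemma height_lipschitz (x y : CReal) : height x <= height y + CReal_abs (x - y).
Proof.
  apply dyadic_series_le; [apply CReal_abs_pos|].
  intros i; apply bump_lipschitz.
Qed.

Lemma height_bounds (x : CReal) : 0 <= height x <= 1.
Proof.
  destruct (dyadic_series_bounds (interval_bump_bounds x) 0) as [H1 H2].
  split; [exact H1|].
  apply (CReal_le_trans _ _ _ H2); simpl; rewrite CReal_plus_0_l.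
  apply CRealLe_refl.
Qed.

Lemma height_pos (CMT : ChurchMarkovTuring) (x : CReal) : 0 <' height x.
Proof.
  destruct (interval_cover CMT x) as [n Hn]; apply CRealLtForget.
  apply (@dyadic_series_pos _ _ n), bump_pos, CRealLtEpsilon, Hn.
Qed.

(** * The mapping x h(x) and its zero set *)

Lemma ui_nonneg (x : unit_interval) : 0 <= x.
Proof. apply (ui_bounds x). Qed.

Lemma ui_le_1 (x : unit_interval) : x <= 1.
Proof. apply (ui_bounds x). Qed.

(** Write x h(x) - y h(y) = (x - y) h(x) + y (h(x) - h(y)) and use h(x) <= 1, y <= 1 and the
    Lipschitz bound for h. *)
Lemma scaled_height_lipschitz (x y : unit_interval) :
  CReal_abs (x * height x - y * height y) <= CReal_abs (x - y) + CReal_abs (x - y).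
Proof.
  assert (H : forall x y : unit_interval,
    x * height x <= y * height y + (CReal_abs (x - y) + CReal_abs (x - y))).
  { clear x y; intros x y; destruct (height_bounds x) as [H0 H1].
    pose proof (CReal_mult_le_compat_r _ _ _ H0 (CReal_le_abs (x - y))) as Hx.
    pose proof (CReal_mult_le_compat_l _ _ _ (CReal_abs_pos (x - y)) H1) as Hx'.
    pose proof (CReal_mult_le_compat_l _ _ _ (@ui_nonneg y) (@height_lipschitz x y)) as Hy.
    pose proof (CReal_mult_le_compat_r _ _ _ (CReal_abs_pos (x - y)) (@ui_le_1 y)) as Hy'.
    apply (CReal_le_of_sub (CReal_plus_le_compat _ _ _ _
      (CReal_plus_le_compat _ _ _ _ Hx Hx') (CReal_plus_le_compat _ _ _ _ Hy Hy'))).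
    ring. }
  apply CReal_abs_le_swap; [apply H|].
  rewrite (CReal_abs_minus_sym x y); apply H.
Qed.

(** The Lipschitz bound gives extensionality without tracing the construction of the limit. *)
Lemma scaled_height_ext (x y : unit_interval) :
  x == y -> x * height x == y * height y.
Proof.
  intros E.
  assert (H : CReal_abs (x * height x - y * height y) <= 0).
  { apply (CReal_le_trans _ _ _ (@scaled_height_lipschitz x y)).
    assert (E' : CReal_abs (x - y) == 0).
    { setoid_replace (x - y) with 0 by (rewrite E; ring).
      apply CReal_abs_right, CRealLe_refl. }
    rewrite E', CReal_plus_0_l; apply CRealLe_refl. }
  destruct (CReal_abs_def2 _ _ H) as [H1 H2]; split.
  - apply (CReal_le_of_sub H2); ring.
  - apply (CReal_le_of_sub H1); ring.
Qed.

Definition scaled_height : mapping := Mapping scaled_height_ext.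

(** For the forward direction, 0 < x would make x h(x) positive, and refuting 0 < x is what x <= 0
    means; Markov's principle does not enter. *)
Lemma zero_set_scaled_height (CMT : ChurchMarkovTuring) (x : unit_interval) :
  zero_set scaled_height x <-> x == 0.
Proof.
  unfold zero_set; simpl; split; intros H.
  - split; [exact (@ui_nonneg x)|]; intros Hx.
    apply (CRealLt_irrefl 0), (CRealLt_proper_r (x * height x)); [exact H|].
    apply (CReal_mult_lt_0_compat _ _ Hx), CRealLtEpsilon, (height_pos CMT).
  - rewrite (CReal_mult_proper_r _ _ _ H); ring.
Qed.

Definition ui_zero : unit_interval :=
  @UnitInterval 0 (conj (CRealLe_refl 0) (CRealLt_asym _ _ CRealLt_0_1)).

Lemma CReal_abs_minus_0 (x : unit_interval) (y : CReal) :
  y == 0 -> CReal_abs (x - y) == x.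
Proof.
  intros ->; setoid_replace (x - 0) with (ui_val x) by ring.
  apply CReal_abs_right, ui_nonneg.
Qed.

Theorem mainTheorem7 (DC : FunctionalDependentChoice) (CMT : ChurchMarkovTuring) :
  exists f : mapping,
    uniformly_continuous f /\
    Z_stable f /\
    inhabited_subset (zero_set f) /\
    located (zero_set f) /\
    ~ uniformly_Z_stable f.
Proof.
  pose proof (zero_set_scaled_height CMT) as HZ.
  exists scaled_height; split; [|split; [|split; [|split]]].
  (* The Lipschitz constant 2 dictates half of [eps]. *)
  - intros eps Heps; exists (eps * inject_Q (1 # 2)); split.
    + apply CRealLtForget, CReal_mult_lt_0_compat;
        [apply CRealLtEpsilon, Heps | apply inject_Q_lt; reflexivity].
    + intros x y Hxy; apply CRealLtEpsilon in Hxy; apply CRealLtForget.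
      apply (CReal_le_lt_trans _ _ _ (@scaled_height_lipschitz x y)).
      apply (CReal_lt_le_trans _ _ _ (CReal_plus_le_lt_compat _ _ _ _
        (CRealLt_asym _ _ Hxy) Hxy)).
      rewrite <- CReal_mult_plus_distr_l, <- inject_Q_plus.
      change (inject_Q ((1 # 2) + (1 # 2))) with (inject_Q (4 # 4)).
      setoid_replace (4 # 4)%Q with 1%Q by reflexivity.
      rewrite CReal_mult_1_r; apply CRealLe_refl.
  - intros x eps Heps; apply CRealLtEpsilon in Heps.
    (* Cotransitivity gives 0 < x or x < eps. In the first case delta = f(x) > 0 makes the premise
       |f(x)| < delta absurd; in the second the zero 0 is close enough and any delta works. *)
    destruct (CRealLt_dec _ _ (ui_val x) Heps) as [Hx|Hx].
    + assert (Hf : 0 < scaled_height x).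
      { apply CReal_mult_lt_0_compat;
          [exact Hx | apply CRealLtEpsilon, (height_pos CMT)]. }
      exists (scaled_height x); split; [apply CRealLtForget, Hf|].
      intros H; apply CRealLtEpsilon in H; exfalso.
      exact (CReal_le_abs _ H).
    + exists 1; split; [apply CRealLtForget, CRealLt_0_1|]; intros _.
      exists ui_zero; split; [apply HZ; reflexivity|].
      rewrite CReal_abs_minus_0 by reflexivity; apply CRealLtForget, Hx.
  - exists ui_zero; apply HZ; reflexivity.
  (* As 0 is the only zero, the distance from x to the zero set is x itself. *)
  - intros x; exists x; split.
    + intros y Hy; apply HZ in Hy; rewrite (CReal_abs_minus_0 x Hy).
      apply CRealLe_refl.
    + intros eps Heps; exists ui_zero; split; [apply HZ; reflexivity|].
      rewrite CReal_abs_minus_0 by reflexivity.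
      apply CRealLtEpsilon in Heps; apply CRealLtForget.
      apply (CReal_lt_of_sub Heps); ring.
  - intros Hunif; destruct (interval_cover CMT 0) as [n0 Hn0].
    set (c := fst (interval n0)) in *; set (r := snd (interval n0)) in *.
    setoid_replace (0 - inject_Q c) with (- inject_Q c) in Hn0 by ring.
    apply CRealLtEpsilon in Hn0.
    rewrite CReal_abs_opp, <- Qabs_Rabs in Hn0; apply lt_inject_Q in Hn0.
    (* Points of [0,1] closer to 0 than r - |c| lie in the interval [n0]. *)
    destruct (Hunif (inject_Q (r - Qabs c))) as (delta & Hdelta & H).
    { apply CRealLtForget, inject_Q_lt; lra. }
    apply CRealLtEpsilon in Hdelta.
    destruct (CRealQ_dense _ _ Hdelta) as (q & Hq0 & Hq).
    apply lt_inject_Q in Hq0.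
    (* The first summand places [n0] among the avoided intervals; the second gives 2^-N <= 1 /
       [Qden q] <= q < delta. *)
    set (N := (S n0 + Pos.to_nat (Qden q))%nat).
    destruct (interval_finite_avoid N) as (a & Ha & Havoid).
    assert (Hui : 0 <= inject_Q a <= 1) by (split; apply inject_Q_le; apply Ha).
    set (x := UnitInterval Hui).
    assert (Hsmall : scaled_height x < delta).
    (* The chain is x h(x) <= h(x) <= 2^-N <= q < delta, the second bound because the first [N]
       bumps vanish at [a]. *)
    { apply (fun H => CReal_le_lt_trans _ _ _ H Hq).
      apply (CReal_le_trans _ (1 * height x)).
      - apply CReal_mult_le_compat_r; [apply height_bounds | apply ui_le_1].
      - rewrite CReal_mult_1_l.
        apply (CReal_le_trans _ (inject_Q (dyad N))).
        + apply dyadic_series_small; intros i Hi; apply bump_zero.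
          destruct (Havoid i Hi) as [Hai|Hai]; apply inject_Q_le in Hai; simpl.
          * rewrite CReal_abs_minus_sym.
            refine (CReal_le_trans _ _ _ _ (CReal_le_abs _)).
            unfold Qminus in Hai; rewrite inject_Q_plus, opp_inject_Q in Hai.
            apply (CReal_le_of_sub Hai); ring.
          * refine (CReal_le_trans _ _ _ _ (CReal_le_abs _)).
            rewrite inject_Q_plus in Hai; apply (CReal_le_of_sub Hai); ring.
        + apply inject_Q_le.
          apply (Qle_trans _ (dyad (Pos.to_nat (Qden q)))).
          * apply dyad_antitone; unfold N; lia.
          * apply (Qle_trans _ (1 # Qden q)); [apply dyad_archimedean|].
            destruct q as [z d]; unfold Qlt, Qle in *; simpl in *; nia. }
    destruct (H x) as (y & Hy & Hxy).
    { apply CRealLtForget; rewrite CReal_abs_right; [exact Hsmall|].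
      apply CReal_mult_le_0_compat; [apply ui_nonneg | apply height_bounds]. }
    apply HZ in Hy; rewrite (CReal_abs_minus_0 x Hy) in Hxy.
    apply CRealLtEpsilon, lt_inject_Q in Hxy.
    assert (Hn0N : (n0 < N)%nat) by (unfold N; lia).
    pose proof (Qle_Qabs c); pose proof (Qle_Qabs (- c)) as Hc'.
    rewrite Qabs_opp in Hc'.
    (* Left of the interval, a <= c - r < 0; right of it, a >= c + r >= r - |c|, although a < r -
       |c|. *)
    destruct (Havoid n0 Hn0N) as [Hai|Hai]; fold c r in Hai; lra.
Qed.
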